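(* Let $n\ge1$ and let $\alpha_i,\psi_i,\varphi_i$ ($i=1,\dots,n$) and $\nu$ be real numbers. The problem $(P^{dd})$, $$\inf_{\lambda\in\mathbb{R}^n}\ P^{dd}(\lambda)=\sum_{i=1}^n\alpha_i\lambda_i-\sum_{i=1}^n|\psi_i-\alpha_i\varphi_i|\sqrt{2\lambda_i+\varphi_i^2}+\tfrac12\Big(\sum_{i=1}^n\lambda_i-\nu\Big)^2-\sum_{i=1}^n(\psi_i-\alpha_i\varphi_i)\varphi_i\quad\text{s.t. }\lambda_i+\tfrac{\varphi_i^2}{2}\ge0,\ i=1,\dots,n,$$ is equivalent to the problem $$\min_{w\in\mathbb{R}^n}\ F(w)=\tfrac12\Big\{\sum_{i=1}^n\Big[\tfrac12(w_i-\varphi_i)^2-\tfrac{\varphi_i^2}{2}\Big]-\nu\Big\}^2+\sum_{i=1}^n\Big\{\alpha_i\Big[\tfrac12(w_i-\varphi_i)^2-\tfrac{\varphi_i^2}{2}\Big]-(\psi_i-\alpha_i\varphi_i)w_i\Big\}$$ $$\text{s.t. }(\psi_i-\alpha_i\varphi_i)(w_i-\varphi_i)\ge0,\ i=1,\dots,n,$$ in the following sense: under the transformation $\lambda_i=\tfrac12(w_i-\varphi_i)^2-\tfrac{\varphi_i^2}{2}$, $i=1,\dots,n$, every feasible $w$ of the second problem is mapped to a feasible point $\lambda$ of $(P^{dd})$ with $P^{dd}(\lambda)=F(w)$, and every feasible $\lambda$ of $(P^{dd})$ is the image of some feasible $w$ of the second problem with $F(w)=P^{dd}(\lambda)$.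
   Context: $F$ is the objective of the (diagonalized) double well potential problem: by completing squares, $F(w)=\tfrac12\Lambda(w)^2+\sum_{i=1}^n(\tfrac12\alpha_iw_i^2-\psi_iw_i)$ with $\Lambda(w)=\sum_{i=1}^n(\tfrac12w_i^2-\varphi_iw_i)-\nu$. So the second problem is the double well problem with $n$ additional linear constraints. $(P^{dd})$ is the Lagrangian dual of the canonical dual problem of the double well problem. *)

(* Defs.v *)
From mathcomp Require Import all_boot all_order all_algebra.
From mathcomp Require Import reals.

Set Implicit Arguments.
Unset Strict Implicit.
Unset Printing Implicit Defensive.

Import Order.TTheory GRing.Theory Num.Theory.
Local Open Scope ring_scope.

(* [Num.sqrt] is 0 at negative arguments, but on the feasible set
   [Pdd_feasible] every argument [2 * lam_i + phi_i ^+ 2] is nonnegative. *)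
Definition Pdd (R : realType) (n : nat) (alpha psi phi : 'rV[R]_n) (nu : R)
    (lam : 'rV[R]_n) : R :=
  \sum_(i < n) alpha 0 i * lam 0 i
  - \sum_(i < n) `|psi 0 i - alpha 0 i * phi 0 i|
                 * Num.sqrt (2 * lam 0 i + phi 0 i ^+ 2)
  + 1 / 2 * (\sum_(i < n) lam 0 i - nu) ^+ 2
  - \sum_(i < n) (psi 0 i - alpha 0 i * phi 0 i) * phi 0 i.

Definition Pdd_feasible (R : realType) (n : nat) (phi lam : 'rV[R]_n) : Prop :=
  forall i : 'I_n, 0 <= lam 0 i + phi 0 i ^+ 2 / 2.

Definition F (R : realType) (n : nat) (alpha psi phi : 'rV[R]_n) (nu : R)
    (w : 'rV[R]_n) : R :=
  1 / 2 * (\sum_(i < n) (1 / 2 * (w 0 i - phi 0 i) ^+ 2 - phi 0 i ^+ 2 / 2)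
           - nu) ^+ 2
  + \sum_(i < n) (alpha 0 i
                    * (1 / 2 * (w 0 i - phi 0 i) ^+ 2 - phi 0 i ^+ 2 / 2)
                  - (psi 0 i - alpha 0 i * phi 0 i) * w 0 i).

Definition F_feasible (R : realType) (n : nat) (alpha psi phi w : 'rV[R]_n)
    : Prop :=
  forall i : 'I_n,
    0 <= (psi 0 i - alpha 0 i * phi 0 i) * (w 0 i - phi 0 i).

Definition lambda_of (R : realType) (n : nat) (phi w : 'rV[R]_n) : 'rV[R]_n :=
  \row_(i < n) (1 / 2 * (w 0 i - phi 0 i) ^+ 2 - phi 0 i ^+ 2 / 2).

(* Main.v *)
(** Write [c i := psi i - alpha i * phi i].  Under the transformation,
    [2 * lam i + phi i ^+ 2] is the square of [w i - phi i], so the sign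
    constraint [0 <= c i * (w i - phi i)] says exactly that
    [`|c i| * sqrt (2 * lam i + phi i ^+ 2) = c i * (w i - phi i)].
    Conversely, the preimage of [lam] whose displacement [w i - phi i] has the
    sign of [c i] is feasible. *)
Require Import Defs.
From mathcomp Require Import all_boot all_order all_algebra.
From mathcomp Require Import reals.
From mathcomp Require Import ring lra.

Import Order.TTheory GRing.Theory Num.Theory.
Local Open Scope ring_scope.

Lemma sqr_lambda_of (R : realType) (n : nat) (phi w : 'rV[R]_n) (i : 'I_n) :
  2 * lambda_of phi w 0 i + phi 0 i ^+ 2 = (w 0 i - phi 0 i) ^+ 2.
Proof. by rewrite mxE; field. Qed.

Lemma lambda_of_feasible (R : realType) (n : nat) (phi w : 'rV[R]_n) :
  Pdd_feasible phi (lambda_of phi w).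
Proof.
move=> i; have := sqr_ge0 (w 0 i - phi 0 i).
by rewrite -sqr_lambda_of; lra.
Qed.

Lemma Pdd_lambda_of (R : realType) (n : nat) (alpha psi phi : 'rV[R]_n)
    (nu : R) (w : 'rV[R]_n) :
  F_feasible alpha psi phi w ->
  Pdd alpha psi phi nu (lambda_of phi w) = F alpha psi phi nu w.
Proof.
move=> w_feas; rewrite /Pdd /F.
(* The squared term is split off; the rest is compared index by index. *)
rewrite [LHS]addrAC [LHS]addrC; congr (_ + _).
  by under eq_bigr do rewrite mxE.
rewrite -!sumrB; apply: eq_bigr => i _.
rewrite sqr_lambda_of sqrtr_sqr -normrM ger0_norm ?w_feas // mxE.
(* The constant term of [Pdd] completes [c i * (w i - phi i)] to [c i * w i]. *)
by ring.
Qed.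

(** The sign is a power of [-1] so that it is [1], not [0], when [c i = 0]: its square must be [1]
    for [lam] to be recovered. *)
Definition preimage_of {R : realType} {n : nat}
    (alpha psi phi lam : 'rV[R]_n) : 'rV[R]_n :=
  \row_(i < n) (phi 0 i
    + (-1) ^+ (psi 0 i - alpha 0 i * phi 0 i < 0)%R
      * Num.sqrt (2 * lam 0 i + phi 0 i ^+ 2)).

Lemma preimage_of_feasible (R : realType) (n : nat)
    (alpha psi phi lam : 'rV[R]_n) :
  F_feasible alpha psi phi (preimage_of alpha psi phi lam).
Proof.
(* The sign times [c i] is [|c i|]. *)
move=> i; rewrite mxE addrAC subrr add0r mulrA [X in X * _]mulrC -normrEsign.
by rewrite mulr_ge0 ?sqrtr_ge0.
Qed.

Lemma preimage_ofK (R : realType) (n : nat) (alpha psi phi lam : 'rV[R]_n) :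
  Pdd_feasible phi lam -> lambda_of phi (preimage_of alpha psi phi lam) = lam.
Proof.
move=> lam_feas; apply/rowP => i; rewrite !mxE addrAC subrr add0r.
rewrite exprMn sqrr_sign mul1r sqr_sqrtr; first by field.
(* The radicand is twice the quantity that feasibility of [lam] makes nonnegative. *)
by have := lam_feas i; lra.
Qed.

Theorem theorem2 (R : realType) (n : nat) (hn : (1 <= n)%N)
    (alpha psi phi : 'rV[R]_n) (nu : R) :
  (forall w : 'rV[R]_n, F_feasible alpha psi phi w ->
     Pdd_feasible phi (lambda_of phi w) /\
     Pdd alpha psi phi nu (lambda_of phi w) = F alpha psi phi nu w) /\
  (forall lam : 'rV[R]_n, Pdd_feasible phi lam ->
     exists w : 'rV[R]_n,
       F_feasible alpha psi phi w /\
       lambda_of phi w = lam /\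
       F alpha psi phi nu w = Pdd alpha psi phi nu lam).
Proof.
split=> [w w_feas|lam lam_feas].
  by split; [exact: lambda_of_feasible|exact: Pdd_lambda_of].
have w_feas := @preimage_of_feasible R n alpha psi phi lam.
have wK := @preimage_ofK R n alpha psi phi lam lam_feas.
exists (preimage_of alpha psi phi lam); do 2!split=> //.
by rewrite -Pdd_lambda_of // wK.
Qed.
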